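(* Let $\Delta t>0$, $T>0$ and $N_T=\lfloor T/\Delta t\rfloor$, and set $t^n=n\Delta t$. For each $\varepsilon>0$ let $(\mathbf{x}^n_\varepsilon,\mathbf{w}^n_\varepsilon,e^n_\varepsilon)_{0\le n\le N_T}$ (with values in $\mathbb{R}^2\times\mathbb{R}^2\times\mathbb{R}$) be a sequence obtained by the scheme (index $\varepsilon$ omitted) $$ \left\{ \begin{array}{l} \displaystyle\frac{\mathbf{x}^{n+1}-\mathbf{x}^n}{\Delta t}=\frac{\mathbf{w}^{n+1}}{\varepsilon},\\[1em] \displaystyle\frac{e^{n+1}-e^n}{\Delta t}=\mathbf{E}(t^n,\mathbf{x}^n)\cdot\frac{\mathbf{w}^{n+1}}{\varepsilon},\\[1em] \displaystyle\frac{\mathbf{w}^{n+1}-\mathbf{w}^n}{\Delta t}=\frac1\varepsilon\left(\mathbf{E}(t^n,\mathbf{x}^n)-\chi(e^n,\mathbf{w}^n)\,\nabla_{\mathbf{x}}(\ln b)(t^n,\mathbf{x}^n)-b(t^n,\mathbf{x}^n)\frac{(\mathbf{w}^{n+1})^\perp}{\varepsilon}\right), \end{array}\right. $$ and assume that - for all $1\le n\le N_T$, $(\mathbf{x}^n_\varepsilon,\varepsilon\mathbf{w}^n_\varepsilon,e^n_\varepsilon)_{\varepsilon>0}$ is uniformly bounded with respect to $\varepsilon>0$; - $(\mathbf{x}^0_\varepsilon,\mathbf{w}^0_\varepsilon,e^0_\varepsilon)_{\varepsilon>0}$ converges as $\varepsilon\to0$ to some $(\mathbf{y}^0,\mathbf{w}^0,g^0)$.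 Then, for any $1\le n\le N_T$, $(\mathbf{x}^n_\varepsilon,e^n_\varepsilon)_{\varepsilon>0}$ converges to some $(\mathbf{y}^n,g^n)$ as $\varepsilon\to0$, and the limiting sequence $(\mathbf{y}^n,g^n)_{1\le n\le N_T}$ solves (for $1\le n\le N_T-1$) $$ \left\{ \begin{array}{l} \displaystyle\frac{\mathbf{y}^{n+1}-\mathbf{y}^n}{\Delta t}=-\frac{1}{b(t^n,\mathbf{y}^n)}\Big(\mathbf{E}(t^n,\mathbf{y}^n)-g^n\,\nabla_{\mathbf{y}}(\ln b)(t^n,\mathbf{y}^n)\Big)^\perp,\\[1em] \displaystyle\frac{g^{n+1}-g^n}{\Delta t}=g^n\,\frac{\nabla_{\mathbf{y}}^\perp b}{b^2}(t^n,\mathbf{y}^n)\cdot\mathbf{E}(t^n,\mathbf{y}^n), \end{array}\right. $$ which provides a consistent first-order approximation with respect to $\Delta t$ of the gyro-kinetic system $$ \frac{\mathrm{d}\mathbf{Y}}{\mathrm{d}t}=\mathbf{F}(t,\mathbf{Y})+g\,\frac{\nabla_{\mathbf{x}}^\perp b}{b^2}(t,\mathbf{Y}),\qquad \frac{\mathrm{d}g}{\mathrm{d}t}=-\mathrm{div}_{\mathbf{x}}(\mathbf{F})(t,\mathbf{Y})\,g,\qquad \mathbf{F}:=-\frac{1}{b}\mathbf{E}^\perp . $$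
   Context: For $\mathbf{a}=(a_1,a_2)\in\mathbb{R}^2$, $\mathbf{a}^\perp=(-a_2,a_1)$; $\nabla^\perp b=(\nabla b)^\perp=(-\partial_{x_2}b,\partial_{x_1}b)$, where gradients and divergences are with respect to the space variable. The fields $\mathbf{E}:\mathbb{R}^+\times\mathbb{R}^2\to\mathbb{R}^2$ and $b:\mathbb{R}^+\times\mathbb{R}^2\to\mathbb{R}$ are given, smooth and independent of $\varepsilon$; there is $b_0>0$ such that $b(t,\mathbf{x})\ge b_0$ for all $(t,\mathbf{x})\in\mathbb{R}^+\times\mathbb{R}^2$; and $\mathbf{E}=-\nabla_{\mathbf{x}}\phi$ derives from a potential $\phi$ (so $\partial_{x_1}E_2-\partial_{x_2}E_1=0$). The function $\chi:\mathbb{R}\times\mathbb{R}^2\to\mathbb{R}$ is continuous and satisfies: $\chi(\tfrac12\|\mathbf{w}\|^2,\mathbf{w})=0$ for all $\mathbf{w}\in\mathbb{R}^2$; $\lim_{\mathbf{w}\to0}\chi(e,\mathbf{w})=e$ for all $e\in\mathbb{R}$; $0\le\chi(e,\mathbf{w})\le e$ for all $(e,\mathbf{w})\in\mathbb{R}_+\times\mathbb{R}^2$. A one-step scheme is a consistent approximation of order $p$ of an ODE system if, applying one step of size $\Delta t$ of the scheme to the value at time $t^n$ of a smooth exact solution, the result differs from the exact solution at time $t^n+\Delta t$ by $O(\Delta t^{p+1})$ as $\Delta t\to0$. *)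

(* Defs.v *)
From Stdlib Require Export Reals.
From Coquelicot Require Export Coquelicot.
Open Scope R_scope.

(* Coquelicot's [norm] on a product of normed modules is the Euclidean
   combination sqrt (|.|^2 + |.|^2), so [norm] on R2 is the Euclidean norm. *)
Notation R2 := (R * R)%type.

Definition perp (a : R2) : R2 := (- snd a, fst a).

Definition dot (a c : R2) : R := fst a * fst c + snd a * snd c.

Definition grad (f : R2 -> R) (x : R2) : R2 :=
  (Derive (fun s => f (s, snd x)) (fst x),
   Derive (fun s => f (fst x, s)) (snd x)).

Definition grad_perp (f : R2 -> R) (x : R2) : R2 := perp (grad f x).

Definition div (f : R2 -> R2) (x : R2) : R :=
  Derive (fun s => fst (f (s, snd x))) (fst x)
  + Derive (fun s => snd (f (fst x, s))) (snd x).

(* C^k regularity relative to a set D with enough points for Frechet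
   derivatives relative to D to be unique; here D is a half-space or a
   nondegenerate segment, and derivatives are one-sided on its boundary. *)
Fixpoint Ck_on {V W : NormedModule R_AbsRing} (k : nat)
    (D : V -> Prop) (f : V -> W) : Prop :=
  match k with
  | O => forall x, D x -> filterlim f (within D (locally x)) (locally (f x))
  | S k' =>
      exists f' : V -> V -> W,
        (forall x, D x -> filterdiff f (within D (locally x)) (f' x)) /\
        (forall v, Ck_on k' D (fun x => f' x v))
  end.

Definition smooth_on {V W : NormedModule R_AbsRing}
    (D : V -> Prop) (f : V -> W) : Prop :=
  forall k, Ck_on k D f.

(* Fields are total in t, but only their values at t >= 0 are meaningful. *)
Definition smooth_field {W : NormedModule R_AbsRing} (f : R -> R2 -> W) : Prop :=
  smooth_on (fun p : R * R2 => 0 <= fst p)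
            (fun p : R * R2 => f (fst p) (snd p)).

Definition derives_from_potential (E : R -> R2 -> R2) : Prop :=
  exists phi : R -> R2 -> R,
    forall t x, 0 <= t ->
      ex_filterdiff (phi t) (locally x) /\ E t x = opp (grad (phi t) x).

Definition admissible_chi (chi : R -> R2 -> R) : Prop :=
  (forall p : R * R2, continuous (fun q : R * R2 => chi (fst q) (snd q)) p) /\
  (forall w : R2, chi (/ 2 * norm w ^ 2) w = 0) /\
  (forall e : R, filterlim (chi e) (locally' (zero : R2)) (locally e)) /\
  (forall (e : R) (w : R2), 0 <= e -> 0 <= chi e w <= e).

Definition scheme (E : R -> R2 -> R2) (b : R -> R2 -> R) (chi : R -> R2 -> R)
    (eps dt t : R) (x w : R2) (e : R) (x' w' : R2) (e' : R) : Prop :=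
  scal (/ dt) (minus x' x) = scal (/ eps) w' /\
  (e' - e) / dt = dot (E t x) (scal (/ eps) w') /\
  scal (/ dt) (minus w' w) =
    scal (/ eps)
      (minus (minus (E t x) (scal (chi e w) (grad (fun z => ln (b t z)) x)))
             (scal (b t x) (scal (/ eps) (perp w')))).

Definition limit_scheme (E : R -> R2 -> R2) (b : R -> R2 -> R)
    (dt t : R) (s s' : R2 * R) : Prop :=
  let (y, g) := s in
  let (y', g') := s' in
  scal (/ dt) (minus y' y) =
    opp (scal (/ b t y)
          (perp (minus (E t y) (scal g (grad (fun z => ln (b t z)) y))))) /\
  (g' - g) / dt = g * dot (scal (/ b t y ^ 2) (grad_perp (b t) y)) (E t y).

Definition drift (E : R -> R2 -> R2) (b : R -> R2 -> R) (t : R) (x : R2) : R2 :=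
  opp (scal (/ b t x) (perp (E t x))).

Definition gyrokinetic (E : R -> R2 -> R2) (b : R -> R2 -> R)
    (t : R) (s : R2 * R) : R2 * R :=
  let (y, g) := s in
  (plus (drift E b t y) (scal g (scal (/ b t y ^ 2) (grad_perp (b t) y))),
   - div (drift E b t) y * g).

Definition smooth_solution {V : NormedModule R_AbsRing} (f : R -> V -> V)
    (t0 t1 : R) (u : R -> V) : Prop :=
  let I t := t0 <= t <= t1 in
  smooth_on I u /\
  forall t, I t ->
    filterdiff u (within I (locally t)) (fun h : R => scal h (f t (u t))).

(* [step h t v v'] : one step of size h of the scheme, started from v at time
   t, yields v'.  The constant is uniform in t because the time t^n = n h moves
   with h. *)
Definition consistent_of_order {V : NormedModule R_AbsRing} (p : nat)
    (step : R -> R -> V -> V -> Prop) (f : R -> V -> V) : Prop :=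
  forall (t0 t1 : R) (u : R -> V),
    0 <= t0 < t1 -> smooth_solution f t0 t1 u ->
    exists C delta : R, 0 < delta /\
      forall h t : R, 0 < h < delta -> t0 <= t -> t + h <= t1 ->
        (exists v, step h t (u t) v) /\
        (forall v, step h t (u t) v ->
           norm (minus v (u (t + h))) <= C * h ^ (p + 1)).

(* Main.v *)
Require Import Defs.
From Stdlib Require Import Lra Lia.

(** Put W = w^{n+1} / eps.  The third equation of the scheme says that W solves
    the linear system
      (eps^2 / dt) W + b W^perp
        = E - chi(e^n, w^n) grad (ln b) + (eps / dt) w^n.
    Its matrix is a multiple of a plane rotation with determinant
    (eps^2 / dt)^2 + b^2 >= b0^2, so it is solved explicitly, uniformly in eps.
    As soon as (x^n, w^n, e^n) converges, W therefore converges to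
      V = - (1/b) (E - q grad (ln b))^perp,  q = lim chi(e^n, w^n),
    and hence x^{n+1} and e^{n+1} converge, while w^{n+1} = eps W tends to 0
    ([scheme_step_limit]).  From the second step on the velocity vanishes in the
    limit, where chi(e, 0) = e ([chi_zero_velocity]), so that q = g^n: the limit
    follows the limiting scheme.  In the first step w^0 need not be 0 and q is
    chi(g0, w0) instead, which is why that scheme is only claimed for n >= 1.

    For the consistency, the limiting scheme is the explicit Euler scheme with
    slope (V, E . V) ([limit_scheme_iff_Euler]).  This slope is the gyro-kinetic
    vector field: div F expands into a term in grad b, which is the wanted one,
    and the term (d1 E2 - d2 E1) / b, which vanishes because E is a gradient, by
    Schwarz's theorem ([potential_curl_free], [gyrokinetic_eq_velocity]).  One
    Euler step started on a C^2 solution of an ODE is off by O(h^2), by Taylor's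
    formula; the constant is uniform because u'' is bounded on the compact time
    interval ([Ck_on_2_taylor], [limit_scheme_consistent]). *)

Local Notation VR2 := (prod_NormedModule R_AbsRing R_NormedModule R_NormedModule).

(** * Derivatives relative to a subset *)

(** The limit point of a filter is unique, so shrinking the filter cannot change
    the point at which the derivative is taken. *)
Lemma filterdiff_filter_le {V W : NormedModule R_AbsRing}
  {F G : (V -> Prop) -> Prop} {FG : ProperFilter G}
  (f l : V -> W) (p : V) :
  is_filter_lim F p -> filter_le G F -> filterdiff f F l -> filterdiff f G l.
Proof.
  intros Hp HGF [Hl Hf]; split; [exact Hl|].
  intros x Hx.
  assert (Hpx : p = x).
  { apply (is_filter_lim_unique (F := G)); [|exact Hx].
    intros P HP; apply HGF, Hp, HP. }
  subst x; intros eps; apply HGF, (Hf p Hp).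
Qed.

Lemma is_filter_lim_within {V : UniformSpace} (D : V -> Prop) (p : V) :
  is_filter_lim (within D (locally p)) p.
Proof. intros P HP; apply filter_le_within, HP. Qed.

Lemma Ck_on_linear {V W Z : NormedModule R_AbsRing} (l : W -> Z) (k : nat) :
  is_linear l -> forall (D : V -> Prop) (f : V -> W),
  Ck_on k D f -> Ck_on k D (fun x => l (f x)).
Proof.
  intros Hl; induction k as [|k IH]; intros D f.
  - intros Hf x Hx.
    apply (filterlim_comp _ _ _ f l _ (locally (f x))); [apply Hf, Hx|].
    apply (filterdiff_continuous_aux l); [|intros P HP; exact HP].
    exists l; apply filterdiff_linear, Hl.
  - intros [f' [Hd Hc]].
    exists (fun x v => l (f' x v)); split.
    + intros x Hx.
      apply (filterdiff_comp f l (f' x) l); [apply Hd, Hx|].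
      apply filterdiff_linear, Hl.
    + intros v; apply (IH D (fun x => f' x v)), Hc.
Qed.

(** Although the derivative at p is only relative to D, the derivative along a
    line contained in D is an ordinary two-sided one: this is how spatial partial
    derivatives make sense up to the boundary t = 0 of the half-space. *)
Lemma is_derive_along_line {V W : NormedModule R_AbsRing} (D : V -> Prop)
  (f l : V -> W) (p v : V) (s0 : R) :
  filterdiff f (within D (locally p)) l ->
  (forall s : R, D (plus p (scal (s - s0) v))) ->
  is_derive (fun s : R => f (plus p (scal (s - s0) v))) s0 (l v).
Proof.
  intros Hf HD.
  assert (Hs0 : plus p (scal (s0 - s0) v) = p).
  { rewrite Rminus_diag. etransitivity; [|apply plus_zero_r].
    f_equal. apply (scal_zero_l v). }
  set (c := fun s : R => plus p (scal (s - s0) v)) in *.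
  assert (Hc : filterdiff c (locally s0) (fun h : R => scal h v)).
  { apply (filterdiff_ext_lin c (fun h : R => plus zero (scal h v)));
      [|intros h; apply plus_zero_l].
    apply (filterdiff_plus_fct (fun _ : R => p) (fun s : R => scal (s - s0) v)
             (fun _ => zero) (fun h : R => scal h v));
      [apply filterdiff_const|].
    apply (filterdiff_comp (fun s : R => s - s0) (fun h : R => scal h v)
             (fun h : R => h) (fun h : R => scal h v)).
    - apply (filterdiff_ext_lin (fun s : R => s - s0)
               (fun h : R => minus h zero));
        [|intros h; apply minus_zero_r].
      apply (filterdiff_minus_fct (fun s : R => s) (fun _ => s0)
               (fun h => h) (fun _ => zero));
        [apply filterdiff_id | apply filterdiff_const].
    - apply filterdiff_linear, (is_linear_scal_l (K := R_AbsRing) v). }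
  assert (Hcl : filterlim c (locally s0) (locally p)).
  { assert (Hs := filterdiff_continuous_aux c
              (ex_intro _ _ Hc) s0 (fun P HP => HP)).
    change (c s0) with (plus p (scal (s0 - s0) v)) in Hs.
    rewrite Hs0 in Hs; exact Hs. }
  unfold is_derive.
  apply (filterdiff_ext_lin _ (fun h : R => l (scal h v)));
    [|intros h; exact (linear_scal l (proj1 Hf) h v)].
  apply (filterdiff_comp c f (fun h : R => scal h v) l); [exact Hc|].
  apply (filterdiff_filter_le (F := within D (locally p))
           (FG := filtermap_proper_filter _ _ c _ (locally_filter s0)) _ _ p);
    [apply is_filter_lim_within | | exact Hf].
  intros P HP.
  unfold filtermap.
  apply (filter_imp (fun s => D (c s) -> P (c s))).
  - intros s Hs; apply Hs, HD.
  - apply (Hcl (fun q => D q -> P q)), HP.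
Qed.

(** * Limits of vector expressions *)

Section PairLimits.
Context {T : Type} {F : (T -> Prop) -> Prop} {FF : Filter F}.

Lemma filterlim_fst_comp {U V : UniformSpace} (f : T -> U * V) (l : U * V) :
  filterlim f F (locally l) -> filterlim (fun t => fst (f t)) F (locally (fst l)).
Proof.
  intros Hf; destruct l as [a c].
  apply (filterlim_comp _ _ _ f fst _ _ _ Hf), continuous_fst.
Qed.

Lemma filterlim_snd_comp {U V : UniformSpace} (f : T -> U * V) (l : U * V) :
  filterlim f F (locally l) -> filterlim (fun t => snd (f t)) F (locally (snd l)).
Proof.
  intros Hf; destruct l as [a c].
  apply (filterlim_comp _ _ _ f snd _ _ _ Hf), continuous_snd.
Qed.

Lemma filterlim_pair_comp {U V : UniformSpace} (f : T -> U) (g : T -> V)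
  (a : U) (c : V) :
  filterlim f F (locally a) -> filterlim g F (locally c) ->
  filterlim (fun t => (f t, g t)) F (locally (a, c)).
Proof.
  intros Hf Hg; apply filterlim_locally; intros eps.
  apply (filter_and (fun t => ball a eps (f t)) (fun t => ball c eps (g t))).
  - apply (proj1 (filterlim_locally f a) Hf).
  - apply (proj1 (filterlim_locally g c) Hg).
Qed.

Lemma filterlim_plus_comp {V : NormedModule R_AbsRing} (f g : T -> V) (a c : V) :
  filterlim f F (locally a) -> filterlim g F (locally c) ->
  filterlim (fun t => plus (f t) (g t)) F (locally (plus a c)).
Proof.
  intros Hf Hg; apply (filterlim_comp_2 f g plus Hf Hg), filterlim_plus.
Qed.

Lemma filterlim_opp_comp {V : NormedModule R_AbsRing} (f : T -> V) (a : V) :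
  filterlim f F (locally a) ->
  filterlim (fun t => opp (f t)) F (locally (opp a)).
Proof.
  intros Hf; apply (filterlim_comp _ _ _ f opp _ _ _ Hf), filterlim_opp.
Qed.

Lemma filterlim_minus_comp {V : NormedModule R_AbsRing} (f g : T -> V) (a c : V) :
  filterlim f F (locally a) -> filterlim g F (locally c) ->
  filterlim (fun t => minus (f t) (g t)) F (locally (minus a c)).
Proof.
  intros Hf Hg; apply filterlim_plus_comp, filterlim_opp_comp; assumption.
Qed.

Lemma filterlim_scal_comp {V : NormedModule R_AbsRing} (k : T -> R) (f : T -> V)
  (m : R) (a : V) :
  filterlim k F (locally m) -> filterlim f F (locally a) ->
  filterlim (fun t => scal (k t) (f t)) F (locally (scal m a)).
Proof.
  intros Hk Hf.
  apply (filterlim_comp_2 k f (fun (k : R_AbsRing) x => scal k x) Hk Hf).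
  apply (filterlim_scal (K := R_AbsRing) (V := V) m a).
Qed.

Lemma filterlim_scal_zero {V : NormedModule R_AbsRing} (k : T -> R) (f : T -> V)
  (a : V) :
  filterlim k F (locally 0) -> filterlim f F (locally a) ->
  filterlim (fun t => scal (k t) (f t)) F (locally (zero : V)).
Proof.
  intros Hk Hf; replace (zero : V) with (scal 0 a) by apply (scal_zero_l a).
  exact (filterlim_scal_comp k f 0 a Hk Hf).
Qed.

Lemma filterlim_perp_comp (f : T -> R2) (a : R2) :
  filterlim f F (locally a) -> filterlim (fun t => perp (f t)) F (locally (perp a)).
Proof.
  intros Hf; apply filterlim_pair_comp.
  - apply (filterlim_opp_comp (V := R_NormedModule)), filterlim_snd_comp, Hf.
  - apply filterlim_fst_comp, Hf.
Qed.

Lemma filterlim_dot_comp (f g : T -> R2) (a c : R2) :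
  filterlim f F (locally a) -> filterlim g F (locally c) ->
  filterlim (fun t => dot (f t) (g t)) F (locally (dot a c)).
Proof.
  intros Hf Hg.
  apply (filterlim_plus_comp (V := R_NormedModule));
    apply (filterlim_scal_comp (V := R_NormedModule));
    solve [apply filterlim_fst_comp; assumption
          |apply filterlim_snd_comp; assumption].
Qed.

Lemma filterlim_inv_comp (k : T -> R) (m : R) :
  m <> 0 -> filterlim k F (locally m) ->
  filterlim (fun t => / k t) F (locally (/ m)).
Proof.
  intros Hm Hk; apply (filterlim_comp _ _ _ k Rinv _ _ _ Hk).
  apply continuous_Rinv, Hm.
Qed.

End PairLimits.

(** * Spatial regularity of the fields at a fixed time *)

Definition C1_plane (f : R2 -> R) : Prop :=
  (forall x, continuous f x) /\
  (forall x, ex_derive (fun s => f (s, snd x)) (fst x) /\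
             ex_derive (fun s => f (fst x, s)) (snd x)) /\
  (forall x, continuous (grad f) x).

Lemma is_derive_partials (f d : R2 -> R) (x : R2) :
  (forall (v : R2) (s0 : R),
     is_derive (fun s : R => f (plus x (scal (s - s0) v))) s0 (d v)) ->
  is_derive (fun s : R => f (s, snd x)) (fst x) (d (1, 0)) /\
  is_derive (fun s : R => f (fst x, s)) (snd x) (d (0, 1)).
Proof.
  destruct x as [x1 x2]; intros Hline; split.
  - apply (is_derive_ext (fun s : R => f (plus ((x1, x2) : R2)
                                           (scal (s - x1) ((1, 0) : R2)))));
      [|apply Hline].
    intros s; change (f (x1 + (s - x1) * 1, x2 + (s - x1) * 0) = f (s, x2)).
    f_equal; apply f_equal2; ring.
  - apply (is_derive_ext (fun s : R => f (plus ((x1, x2) : R2)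
                                           (scal (s - x2) ((0, 1) : R2)))));
      [|apply Hline].
    intros s; change (f (x1 + (s - x2) * 0, x2 + (s - x2) * 1) = f (x1, s)).
    f_equal; apply f_equal2; ring.
Qed.

Lemma smooth_field_C1_slice (f : R -> R2 -> R) (t : R) :
  smooth_field f -> 0 <= t -> C1_plane (f t).
Proof.
  intros Hf Ht.
  set (D := fun p : R * R2 => 0 <= fst p) in *.
  assert (Hslice : forall (h : R * R2 -> R) (x : R2),
    filterlim h (within D (locally (t, x))) (locally (h (t, x))) ->
    continuous (fun z => h (t, z)) x).
  { intros h x Hh.
    apply (filterlim_comp _ _ _ (fun z : R2 => (t, z)) h _
             (within D (locally (t, x)))); [|exact Hh].
    intros P HP.
    unfold filtermap.
    apply (filter_imp (fun z : R2 => D (t, z) -> P (t, z)));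
      [intros z Hz; apply Hz, Ht|].
    apply (filterlim_pair_comp (F := locally x) (fun _ : R2 => t) (fun z => z) t x
             (filterlim_const t) (filterlim_id _ _) (fun q => D q -> P q)), HP. }
  destruct (Hf 1%nat) as [f' [Hd Hc]].
  assert (Hline : forall (x v : R2) (s0 : R),
    is_derive (fun s : R => f t (plus x (scal (s - s0) v))) s0 (f' (t, x) (0, v))).
  { intros x v s0.
    apply is_derive_ext with
      (f := fun s : R => (fun p : R * R2 => f (fst p) (snd p))
               (plus ((t, x) : R * R2) (scal (s - s0) ((0, v) : R * R2)))).
    { intros s.
      change (f (t + (s - s0) * 0) (plus x (scal (s - s0) v))
              = f t (plus x (scal (s - s0) v))).
      f_equal; ring. }
    apply (is_derive_along_line D (fun p : R * R2 => f (fst p) (snd p))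
             (f' (t, x)) (t, x) (0, v) s0); [apply Hd, Ht|].
    intros s; unfold D.
    change (0 <= t + (s - s0) * 0); lra. }
  assert (Hpart := fun x => is_derive_partials (f t) (fun v => f' (t, x) (0, v)) x
                              (Hline x)).
  repeat split.
  - intros x; apply (Hslice (fun p => f (fst p) (snd p))), (Hf 0%nat), Ht.
  - eexists; apply Hpart.
  - eexists; apply Hpart.
  - intros x.
    apply continuous_ext with
      (f := fun z => (f' (t, z) (0, (1, 0)), f' (t, z) (0, (0, 1)))).
    { intros z; unfold grad; f_equal; symmetry; apply is_derive_unique, Hpart. }
    apply (filterlim_pair_comp (fun z => f' (t, z) (0, (1, 0)))
             (fun z => f' (t, z) (0, (0, 1))));
      apply (Hslice (fun p => f' p _)), Hc, Ht.
Qed.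

Lemma grad_ln (f : R2 -> R) (x : R2) :
  C1_plane f -> 0 < f x ->
  grad (fun z => ln (f z)) x = scal (/ f x) (grad f x).
Proof.
  destruct x as [x1 x2]; intros [_ [Hd _]] Hx.
  destruct (Hd (x1, x2)) as [H1 H2].
  assert (Hln : forall (h : R -> R) (s : R), ex_derive h s -> 0 < h s ->
            Derive (fun z => ln (h z)) s = / h s * Derive h s).
  { intros h s Hh Hs; rewrite Rmult_comm; apply is_derive_unique.
    apply (is_derive_comp ln h); [apply is_derive_ln, Hs|].
    apply Derive_correct, Hh. }
  apply injective_projections.
  - exact (Hln (fun s => f (s, x2)) x1 H1 Hx).
  - exact (Hln (fun s => f (x1, s)) x2 H2 Hx).
Qed.

(** * One step of the scheme as eps tends to 0 *)

(** Reduces an equation between coordinates of vector expressions to one between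
    real numbers that [field] recognises. *)
Ltac to_reals :=
  cbn; unfold dot, plus, scal, minus, opp, plus; cbn; unfold mult, plus, opp; cbn;
  match goal with |- @eq _ ?u ?v => change (@eq R u v) end.

(** The inverse of the matrix a I + c J, with J the rotation [perp], applied to r;
    it uses J^2 = - I. *)
Definition rotation_solve (a c : R) (r : R2) : R2 :=
  scal (/ (a ^ 2 + c ^ 2)) (minus (scal a r) (scal c (perp r))).

Lemma rotation_solve_spec (a c : R) (v r : R2) :
  a ^ 2 + c ^ 2 <> 0 -> plus (scal a v) (scal c (perp v)) = r ->
  v = rotation_solve a c r.
Proof.
  intros Hac <-; destruct v as [v1 v2].
  apply injective_projections; to_reals; field; nra.
Qed.

(** The implicit scheme determines w' / eps explicitly, in a form that has a limit
    when eps tends to 0 with w bounded. *)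
Lemma scheme_velocity (E : R -> R2 -> R2) (b : R -> R2 -> R)
  (chi : R -> R2 -> R) (eps dt t : R) (x w x' w' : R2) (e e' : R) :
  0 < eps -> 0 < dt -> b t x <> 0 ->
  scheme E b chi eps dt t x w e x' w' e' ->
  scal (/ eps) w' =
  rotation_solve (eps ^ 2 / dt) (b t x)
    (plus (minus (E t x) (scal (chi e w) (grad (fun z => ln (b t z)) x)))
          (scal (eps / dt) w)).
Proof.
  intros Heps Hdt Hb [_ [_ Hw]].
  set (G := minus (E t x) _) in *; set (c := b t x) in *.
  apply rotation_solve_spec; [assert (0 < c ^ 2) by (apply pow2_gt_0, Hb); nra|].
  revert Hw; generalize (G : R2); intros [G1 G2] Hw; clear G.
  destruct w as [w1 w2], w' as [w1' w2'].
  assert (H1 : / dt * (w1' - w1) = / eps * (G1 - c * (/ eps * - w2')))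
    by exact (f_equal fst Hw).
  assert (H2 : / dt * (w2' - w2) = / eps * (G2 - c * (/ eps * w1')))
    by exact (f_equal snd Hw).
  assert (K1 : @eq R G1 (eps * (/ dt * (w1' - w1)) + c * (/ eps * - w2')))
    by (rewrite H1; field; lra).
  assert (K2 : @eq R G2 (eps * (/ dt * (w2' - w2)) + c * (/ eps * w1')))
    by (rewrite H2; field; lra).
  apply injective_projections.
  - change (eps ^ 2 / dt * (/ eps * w1') + c * - (/ eps * w2')
            = (G1 : R) + eps / dt * w1); rewrite K1; field; lra.
  - change (eps ^ 2 / dt * (/ eps * w2') + c * (/ eps * w1')
            = (G2 : R) + eps / dt * w2); rewrite K2; field; lra.
Qed.

(** The limiting velocity of the guiding centre.  The coefficient q in front of
    grad (ln b) is kept apart from the energy, because the two differ in the first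
    step. *)
Definition gyro_velocity (E : R -> R2 -> R2) (b : R -> R2 -> R)
  (t : R) (y : R2) (q : R) : R2 :=
  opp (scal (/ b t y)
         (perp (minus (E t y) (scal q (grad (fun z => ln (b t z)) y))))).

Lemma rotation_solve_0 (c : R) (r : R2) :
  c <> 0 -> rotation_solve 0 c r = opp (scal (/ c) (perp r)).
Proof.
  intros Hc; destruct r as [r1 r2].
  apply injective_projections; to_reals; field; exact Hc.
Qed.

Lemma filterlim_rotation_solve {T : Type} {F : (T -> Prop) -> Prop} {FF : Filter F}
  (a c : T -> R) (r : T -> R2) (a0 c0 : R) (r0 : R2) :
  c0 <> 0 -> filterlim a F (locally a0) -> filterlim c F (locally c0) ->
  filterlim r F (locally r0) ->
  filterlim (fun t => rotation_solve (a t) (c t) (r t)) F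
    (locally (rotation_solve a0 c0 r0)).
Proof.
  intros Hc0 Ha Hc Hr.
  assert (Hsq : forall (k : T -> R) (m : R), filterlim k F (locally m) ->
            filterlim (fun t => k t ^ 2) F (locally (m ^ 2))).
  { intros k m Hk; apply (filterlim_scal_comp (V := R_NormedModule) k _ m _ Hk).
    apply (filterlim_scal_comp (V := R_NormedModule) k _ m _ Hk), filterlim_const. }
  apply (filterlim_scal_comp (V := VR2)
    (fun t => / (a t ^ 2 + c t ^ 2)) (fun t => minus (scal (a t) (r t)) (scal (c t) (perp (r t))))).
  - apply filterlim_inv_comp;
      [assert (0 < c0 ^ 2) by (apply pow2_gt_0, Hc0); nra|].
    apply (filterlim_plus_comp (V := R_NormedModule)); apply Hsq; assumption.
  - apply (filterlim_minus_comp (V := VR2)); apply (filterlim_scal_comp (V := VR2)); trivial.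
    apply filterlim_perp_comp, Hr.
Qed.

Lemma continuous_grad_ln (f : R2 -> R) (x : R2) :
  C1_plane f -> (forall z, 0 < f z) ->
  continuous (grad (fun z => ln (f z))) x.
Proof.
  intros Hf Hpos.
  apply continuous_ext with (f := fun z => scal (/ f z) (grad f z)).
  - intros z; symmetry; apply grad_ln; [exact Hf | apply Hpos].
  - apply (filterlim_scal_comp (V := VR2) (fun z => / f z) (grad f)).
    + apply filterlim_inv_comp; [apply Rgt_not_eq, Hpos | apply (proj1 Hf)].
    + apply (proj2 (proj2 Hf)).
Qed.

Lemma smooth_field_components (E : R -> R2 -> R2) :
  smooth_field E ->
  smooth_field (fun t x => fst (E t x)) /\ smooth_field (fun t x => snd (E t x)).
Proof.
  intros HE; split; intros k.
  - apply (Ck_on_linear fst k is_linear_fst), HE.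
  - apply (Ck_on_linear snd k is_linear_snd), HE.
Qed.

Lemma at_right_0_lim : filterlim (fun eps : R => eps) (at_right 0) (locally 0).
Proof. intros P HP; apply filter_le_within, HP. Qed.

(** All convergences come from that of w' / eps, which [scheme_velocity] and
    [filterlim_rotation_solve] reduce to those of the data of the step; the limit
    of w' = eps (w' / eps) is then 0. *)
Lemma scheme_step_limit (E : R -> R2 -> R2) (b : R -> R2 -> R) (chi : R -> R2 -> R)
  (dt t q : R) (X W X' W' : R -> R2) (e e' : R -> R) (y wl : R2) (g : R) :
  0 < dt -> (forall x, continuous (E t) x) -> C1_plane (b t) ->
  (forall x, 0 < b t x) ->
  (forall eps, 0 < eps ->
     scheme E b chi eps dt t (X eps) (W eps) (e eps) (X' eps) (W' eps) (e' eps)) ->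
  filterlim X (at_right 0) (locally y) ->
  filterlim W (at_right 0) (locally wl) ->
  filterlim e (at_right 0) (locally g) ->
  filterlim (fun eps => chi (e eps) (W eps)) (at_right 0) (locally q) ->
  filterlim X' (at_right 0)
    (locally (plus y (scal dt (gyro_velocity E b t y q)))) /\
  filterlim W' (at_right 0) (locally (zero : R2)) /\
  filterlim e' (at_right 0)
    (locally (g + dt * dot (E t y) (gyro_velocity E b t y q))).
Proof.
  intros Hdt HE Hb Hpos Hs HX HW He Hchi.
  set (V := gyro_velocity E b t y q).
  assert (HEX : filterlim (fun eps => E t (X eps)) (at_right 0) (locally (E t y)))
    by (apply (filterlim_comp _ _ _ X (E t) _ _ _ HX), HE).
  assert (Hev : forall P : R -> Prop,
            (forall eps, 0 < eps -> P eps) -> at_right 0 P).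
  { intros P HP; unfold at_right, within; apply filter_forall, HP. }
  assert (HV : filterlim (fun eps => scal (/ eps) (W' eps)) (at_right 0) (locally V)).
  { eapply filterlim_ext_loc.
    { apply Hev; intros eps Heps; symmetry.
      apply (scheme_velocity E b chi eps dt t _ _ _ _ _ _ Heps Hdt
               (Rgt_not_eq _ _ (Hpos _)) (Hs eps Heps)). }
    unfold V, gyro_velocity.
    rewrite <- rotation_solve_0 by apply Rgt_not_eq, Hpos.
    set (G := minus (E t y) _).
    assert (Hd : forall k : R -> R, filterlim k (at_right 0) (locally 0) ->
              filterlim (fun eps => k eps / dt) (at_right 0) (locally 0)).
    { intros k Hk.
      apply (filterlim_scal_zero (V := R_NormedModule) k (fun _ => / dt) (/ dt) Hk),
        filterlim_const. }
    apply filterlim_rotation_solve.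
    - apply Rgt_not_eq, Hpos.
    - apply Hd.
      apply (filterlim_scal_zero (V := R_NormedModule) (fun eps => eps)
               (fun eps => eps * 1) 0); [apply at_right_0_lim|].
      apply (filterlim_scal_zero (V := R_NormedModule) (fun eps => eps) _ 1);
        [apply at_right_0_lim | apply filterlim_const].
    - apply (filterlim_comp _ _ _ X (b t) _ _ _ HX), (proj1 Hb).
    - rewrite <- (plus_zero_r G).
      apply (filterlim_plus_comp (V := VR2)).
      + apply (filterlim_minus_comp (V := VR2)); [exact HEX|].
        apply (filterlim_scal_comp (V := VR2)); [exact Hchi|].
        apply (filterlim_comp _ _ _ X _ _ _ _ HX), continuous_grad_ln; assumption.
      + apply (filterlim_scal_zero (V := VR2) (fun eps => eps / dt) W wl);
          [apply Hd, at_right_0_lim | exact HW]. }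
  split; [|split].
  - apply filterlim_ext_loc with
      (f := fun eps => plus (X eps) (scal dt (scal (/ eps) (W' eps)))).
    + apply Hev; intros eps Heps.
      destruct (Hs eps Heps) as [Hx _]; rewrite <- Hx.
      apply injective_projections.
      * change (fst (X eps) + dt * (/ dt * (fst (X' eps) - fst (X eps)))
                = fst (X' eps)); field; lra.
      * change (snd (X eps) + dt * (/ dt * (snd (X' eps) - snd (X eps)))
                = snd (X' eps)); field; lra.
    + apply (filterlim_plus_comp (V := VR2)); [exact HX|].
      apply (filterlim_scal_comp (V := VR2)); [apply filterlim_const | exact HV].
  - apply filterlim_ext_loc with (f := fun eps => scal eps (scal (/ eps) (W' eps))).
    + apply Hev; intros eps Heps.
      apply injective_projections; [change (eps * (/ eps * fst (W' eps)) = fst (W' eps))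
                    |change (eps * (/ eps * snd (W' eps)) = snd (W' eps))];
        field; lra.
    + apply (filterlim_scal_zero (V := VR2) (fun eps => eps) _ V); [apply at_right_0_lim | exact HV].
  - apply filterlim_ext_loc with
      (f := fun eps => e eps + dt * dot (E t (X eps)) (scal (/ eps) (W' eps))).
    + apply Hev; intros eps Heps.
      destruct (Hs eps Heps) as [_ [Hx _]]; rewrite <- Hx; field; lra.
    + apply (filterlim_plus_comp (V := R_NormedModule)); [exact He|].
      apply (filterlim_scal_comp (V := R_NormedModule)); [apply filterlim_const|].
      apply filterlim_dot_comp; [exact HEX | exact HV].
Qed.

(** Continuity of chi turns its limit at zero velocity, taken along w <> 0, into a
    value. *)
Lemma chi_zero_velocity (chi : R -> R2 -> R) (e : R) :
  admissible_chi chi -> chi e zero = e.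
Proof.
  intros [Hc [_ [Hl _]]].
  assert (FP : ProperFilter' (locally' (zero : R2))).
  { split; [|apply locally'_filter].
    intros [d Hd].
    apply (Hd (d / 2, 0)).
    - assert (Hd0 := cond_pos d).
      split; [|apply ball_center].
      change (Rabs (d / 2 - 0) < d); rewrite Rabs_pos_eq; lra.
    - intros H; assert (Hd0 := cond_pos d).
      apply (f_equal fst) in H; change (d / 2 = 0) in H; lra. }
  apply (filterlim_locally_unique (F := locally' (zero : R2)) (chi e)).
  - apply (filterlim_filter_le_1 (F := locally (zero : R2)) (G := locally' (zero : R2))).
    + intros P HP; apply filter_le_within, HP.
    + apply (filterlim_comp _ _ _ (fun w : R2 => (e, w))
               (fun q : R * R2 => chi (fst q) (snd q)) _ (locally ((e, zero) : R * R2)));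
        [|apply Hc].
      apply filterlim_pair_comp; [apply filterlim_const | apply filterlim_id].
  - apply Hl.
Qed.

(** The limits of (x^n, e^n).  The first step uses q0 = chi(g0, w0), since the
    initial velocity need not vanish in the limit. *)
Fixpoint limit_seq (E : R -> R2 -> R2) (b : R -> R2 -> R) (dt q0 : R)
  (s0 : R2 * R) (n : nat) : R2 * R :=
  match n with
  | O => s0
  | S m =>
      let (y, g) := limit_seq E b dt q0 s0 m in
      let V := gyro_velocity E b (INR m * dt) y (match m with O => q0 | S _ => g end) in
      (plus y (scal dt V), g + dt * dot (E (INR m * dt) y) V)
  end.

(** The position equation is the Euler step by definition of the velocity.  For
    the energy, the term - E^perp / b of the velocity does not work against E, being
    orthogonal to it; what is left is the drift along grad^perp b. *)
Lemma limit_scheme_iff_Euler (E : R -> R2 -> R2) (b : R -> R2 -> R)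
  (dt t : R) (y y' : R2) (g g' : R) :
  0 < dt -> C1_plane (b t) -> (forall x, 0 < b t x) ->
  limit_scheme E b dt t (y, g) (y', g') <->
  y' = plus y (scal dt (gyro_velocity E b t y g)) /\
  g' = g + dt * dot (E t y) (gyro_velocity E b t y g).
Proof.
  intros Hdt Hb Hpos.
  assert (Hg : g * dot (scal (/ b t y ^ 2) (grad_perp (b t) y)) (E t y)
               = dot (E t y) (gyro_velocity E b t y g)).
  { unfold gyro_velocity, grad_perp; rewrite grad_ln; trivial.
    assert (H := Hpos y).
    destruct (E t y) as [E1 E2], (grad (b t) y) as [b1 b2].
    to_reals; field; lra. }
  unfold limit_scheme; rewrite Hg; fold (gyro_velocity E b t y g).
  set (V := gyro_velocity E b t y g).
  split; intros [H1 H2]; split.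
  - rewrite <- H1; apply injective_projections.
    + change (fst y' = fst y + dt * (/ dt * (fst y' - fst y))); field; lra.
    + change (snd y' = snd y + dt * (/ dt * (snd y' - snd y))); field; lra.
  - rewrite <- H2; field; lra.
  - rewrite H1; apply injective_projections.
    + change (/ dt * (fst y + dt * fst V - fst y) = fst V); field; lra.
    + change (/ dt * (snd y + dt * snd V - snd y) = snd V); field; lra.
  - rewrite H2; field; lra.
Qed.


(** * The gyro-kinetic vector field *)

Lemma ex_derive_partials (f : R2 -> R) (u v : R) :
  ex_filterdiff f (locally ((u, v) : R2)) ->
  ex_derive (fun s : R => f (s, v)) u /\ ex_derive (fun s : R => f (u, s)) v.
Proof.
  intros [l Hl].
  assert (FP : ProperFilter (within (fun _ : R2 => True) (locally ((u, v) : R2)))).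
  { split; [|apply within_filter, locally_filter].
    intros P HP; exists (u, v).
    apply (locally_singleton _ _ HP I). }
  assert (Hw := filterdiff_locally _ _ _ (is_filter_lim_within _ _) Hl).
  destruct (is_derive_partials f l (u, v)) as [H1 H2].
  { intros v' s0.
    exact (is_derive_along_line _ f l (u, v) v' s0 Hw (fun _ => I)). }
  split; eexists; [exact H1 | exact H2].
Qed.

(** The potential is only assumed differentiable, but its gradient - E is of class
    C^1, which is what Schwarz's theorem requires. *)
Lemma potential_curl_free (E : R -> R2 -> R2) (t : R) (x : R2) :
  derives_from_potential E -> 0 <= t ->
  C1_plane (fun z => fst (E t z)) -> C1_plane (fun z => snd (E t z)) ->
  fst (grad (fun z => snd (E t z)) x) = snd (grad (fun z => fst (E t z)) x).
Proof.
  intros [phi Hphi] Ht [_ [Hd1 Hc1]] [_ [Hd2 Hc2]].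
  destruct x as [x1 x2].
  set (f := fun u v : R => phi t (u, v)).
  assert (HE1 : forall u v, Derive (fun z => f z v) u = - fst (E t (u, v))).
  { intros u v; rewrite (proj2 (Hphi t (u, v) Ht)).
    change (Derive (fun z => phi t (z, v)) u
            = - - Derive (fun z => phi t (z, v)) u); ring. }
  assert (HE2 : forall u v, Derive (fun z => f u z) v = - snd (E t (u, v))).
  { intros u v; rewrite (proj2 (Hphi t (u, v) Ht)).
    change (Derive (fun z => phi t (u, z)) v
            = - - Derive (fun z => phi t (u, z)) v); ring. }
  assert (D12 : forall u v, Derive (fun z => Derive (fun s => f z s) v) u
            = - fst (grad (fun z => snd (E t z)) (u, v))).
  { intros u v; rewrite (Derive_ext _ (fun z => - snd (E t (z, v))));
      [apply Derive_opp | intros z; apply HE2]. }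
  assert (D21 : forall u v, Derive (fun z => Derive (fun s => f s z) u) v
            = - snd (grad (fun z => fst (E t z)) (u, v))).
  { intros u v; rewrite (Derive_ext _ (fun z => - fst (E t (u, z))));
      [apply Derive_opp | intros z; apply HE1]. }
  enough (H : Derive (fun z => Derive (fun s => f z s) x2) x1
            = Derive (fun z => Derive (fun s => f s z) x1) x2)
    by (rewrite D12, D21 in H; lra).
  apply Schwarz.
  - apply locally_2d_forall; intros u v.
    destruct (ex_derive_partials (phi t) u v (proj1 (Hphi t (u, v) Ht))) as [P1 P2].
    repeat split; [exact P1 | exact P2 | |].
    + apply (ex_derive_ext (fun z => - snd (E t (z, v))));
        [intros z; symmetry; apply HE2|].
      apply (ex_derive_opp (V := R_NormedModule)), (Hd2 (u, v)).
    + apply (ex_derive_ext (fun z => - fst (E t (u, z))));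
        [intros z; symmetry; apply HE1|].
      apply (ex_derive_opp (V := R_NormedModule)), (Hd1 (u, v)).
  - apply continuity_2d_pt_ext with
      (f := fun u v => - fst (grad (fun z => snd (E t z)) (u, v)));
      [intros u v; symmetry; apply D12|].
    apply continuity_2d_pt_filterlim.
    apply filterlim_ext with (f := fun z : R2 => opp (fst (grad (fun z => snd (E t z)) z)));
      [intros [u v]; reflexivity|].
    apply (filterlim_opp_comp (V := R_NormedModule)), filterlim_fst_comp, Hc2.
  - apply continuity_2d_pt_ext with
      (f := fun u v => - snd (grad (fun z => fst (E t z)) (u, v)));
      [intros u v; symmetry; apply D21|].
    apply continuity_2d_pt_filterlim.
    apply filterlim_ext with (f := fun z : R2 => opp (snd (grad (fun z => fst (E t z)) z)));
      [intros [u v]; reflexivity|].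
    apply (filterlim_opp_comp (V := R_NormedModule)), filterlim_snd_comp, Hc1.
Qed.

(** With F = (E2 / b, - E1 / b), the quotient rule gives
    div F = (d1 E2 - d2 E1) / b + E^perp . grad b / b^2, and the curl vanishes. *)
Lemma gyrokinetic_eq_velocity (E : R -> R2 -> R2) (b : R -> R2 -> R)
  (t : R) (y : R2) (g : R) :
  C1_plane (fun z => fst (E t z)) -> C1_plane (fun z => snd (E t z)) ->
  C1_plane (b t) -> (forall x, 0 < b t x) ->
  fst (grad (fun z => snd (E t z)) y) = snd (grad (fun z => fst (E t z)) y) ->
  gyrokinetic E b t (y, g) =
  (gyro_velocity E b t y g, dot (E t y) (gyro_velocity E b t y g)).
Proof.
  intros HE1 HE2 Hb Hpos Hcurl.
  assert (Hy := Hpos y).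
  assert (Hdiv : div (drift E b t) y
            = - dot (E t y) (scal (/ b t y ^ 2) (grad_perp (b t) y))).
  { destruct y as [y1 y2].
    destruct (proj1 (proj2 HE1) (y1, y2)) as [_ HE1d].
    destruct (proj1 (proj2 HE2) (y1, y2)) as [HE2d _].
    destruct (proj1 (proj2 Hb) (y1, y2)) as [Hb1 Hb2].
    unfold div.
    rewrite (Derive_ext (fun s => fst (drift E b t (s, snd (y1, y2))))
               (fun s => snd (E t (s, y2)) / b t (s, y2)));
      [|intros s; change (- (/ b t (s, y2) * - snd (E t (s, y2)))
                          = snd (E t (s, y2)) / b t (s, y2)); unfold Rdiv; ring].
    rewrite (Derive_ext (fun s => snd (drift E b t (fst (y1, y2), s)))
               (fun s => - (fst (E t (y1, s)) / b t (y1, s))));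
      [|intros s; change (- (/ b t (y1, s) * fst (E t (y1, s)))
                          = - (fst (E t (y1, s)) / b t (y1, s))); unfold Rdiv; ring].
    rewrite Derive_opp, !Derive_div;
      [|assumption|assumption|apply Rgt_not_eq, Hpos
       |assumption|assumption|apply Rgt_not_eq, Hpos].
    unfold grad in Hcurl; cbn in Hcurl, HE1d, HE2d, Hb1, Hb2 |- *.
    unfold grad_perp, grad, dot; cbn.
    rewrite Hcurl.
    unfold scal; cbn; unfold mult; cbn.
    field; lra. }
  unfold gyrokinetic; rewrite Hdiv.
  unfold gyro_velocity, drift, grad_perp; rewrite grad_ln; trivial.
  destruct (E t y) as [E1 E2], (grad (b t) y) as [b1 b2].
  apply injective_projections; [apply injective_projections|]; to_reals; field; lra.
Qed.

(** * Taylor's formula on a segment *)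

(** One-sided derivatives at the ends of a segment are determined, because the
    segment accumulates at each of its points. *)
Lemma filterdiff_segment_unique (t0 t1 t : R) (u l1 l2 : R -> R) :
  t0 < t1 -> t0 <= t <= t1 ->
  filterdiff u (within (fun s => t0 <= s <= t1) (locally t)) l1 ->
  filterdiff u (within (fun s => t0 <= s <= t1) (locally t)) l2 ->
  l1 1 = l2 1.
Proof.
  intros H01 Ht H1 H2.
  assert (Hd := filterdiff_minus_fct _ _ _ _ H1 H2).
  destruct Hd as [_ Hd].
  specialize (Hd t (is_filter_lim_within _ _)).
  set (m := l1 1 - l2 1).
  enough (Hm : m = 0) by (unfold m in Hm; lra).
  destruct (Req_dec m 0) as [|Hm]; [assumption|exfalso].
  assert (Hm' : 0 < Rabs m) by (apply Rabs_pos_lt, Hm).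
  destruct (Hd (mkposreal (Rabs m / 2) (Rdiv_lt_0_compat _ _ Hm' Rlt_0_2)))
    as [d Hball].
  (* Both sides are tested at a point s of the segment other than t. *)
  assert (Hs : exists s, t0 <= s <= t1 /\ s <> t /\ Rabs (s - t) < d).
  { assert (Hd0 := cond_pos d).
    destruct (Rlt_dec t t1) as [Htt|Htt].
    - exists (Rmin t1 (t + d / 2)); unfold Rmin; destruct (Rle_dec _ _);
        repeat split; try lra; rewrite Rabs_pos_eq; lra.
    - exists (Rmax t0 (t - d / 2)); unfold Rmax; destruct (Rle_dec _ _);
        repeat split; try lra; rewrite Rabs_left; lra. }
  destruct Hs as [s [Hs [Hst Hsd]]].
  specialize (Hball s Hsd Hs).
  assert (HL : forall (l : R -> R) (k : R), is_linear l -> l k = k * l 1).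
  { intros l k Hl; rewrite <- (Rmult_1_r k) at 1.
    exact (linear_scal l Hl k 1). }
  change (Rabs (u s - u s - (u t - u t) - (l1 (s - t) - l2 (s - t)))
          <= Rabs m / 2 * Rabs (s - t)) in Hball.
  rewrite (HL l1), (HL l2) in Hball by (apply H1 || apply H2).
  replace (u s - u s - (u t - u t) - ((s - t) * l1 1 - (s - t) * l2 1))
    with (- (m * (s - t))) in Hball by (unfold m; ring).
  rewrite Rabs_Ropp, Rabs_mult in Hball.
  assert (0 < Rabs (s - t)) by (apply Rabs_pos_lt; lra).
  nra.
Qed.

(** The retraction of the line onto the segment: composing with it extends a
    function continuous relative to the segment to one continuous on the line, to
    which theorems about two-sided continuity apply. *)
Definition clamp (t0 t1 t : R) : R := Rmax t0 (Rmin t1 t).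

Lemma clamp_in (t0 t1 t : R) : t0 <= t1 -> t0 <= clamp t0 t1 t <= t1.
Proof.
  intros H; unfold clamp, Rmax, Rmin.
  destruct (Rle_dec t1 t); destruct (Rle_dec _ _); lra.
Qed.

Lemma clamp_id (t0 t1 t : R) : t0 <= t <= t1 -> clamp t0 t1 t = t.
Proof.
  intros H; unfold clamp, Rmax, Rmin.
  destruct (Rle_dec t1 t); destruct (Rle_dec _ _); lra.
Qed.

Lemma clamp_lipschitz (t0 t1 s t : R) :
  Rabs (clamp t0 t1 s - clamp t0 t1 t) <= Rabs (s - t).
Proof.
  unfold clamp, Rmax, Rmin.
  destruct (Rle_dec t1 s), (Rle_dec t1 t); repeat destruct (Rle_dec _ _);
    unfold Rabs; repeat destruct (Rcase_abs _); lra.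
Qed.

Lemma continuous_clamp (t0 t1 t : R) (u : R -> R) :
  t0 <= t <= t1 ->
  filterlim u (within (fun s => t0 <= s <= t1) (locally t)) (locally (u t)) ->
  continuous (fun s => u (clamp t0 t1 s)) t.
Proof.
  intros Ht Hu; unfold continuous; rewrite (clamp_id t0 t1 t Ht).
  apply (filterlim_comp _ _ _ (clamp t0 t1) u _ _ _) with (2 := Hu).
  intros P [d Hd]; exists d; intros s Hs; apply Hd; [|apply clamp_in; lra].
  apply Rle_lt_trans with (2 := Hs).
  rewrite <- (clamp_id t0 t1 t Ht) at 1.
  apply (clamp_lipschitz t0 t1 s t).
Qed.

Lemma MVT_segment (t0 t1 : R) (u : R -> R) (l : R -> R -> R) :
  (forall t, t0 <= t <= t1 ->
     filterdiff u (within (fun s => t0 <= s <= t1) (locally t)) (l t)) ->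
  forall s t, t0 <= s <= t -> t <= t1 ->
  exists c, s <= c <= t /\ u t - u s = l c 1 * (t - s).
Proof.
  intros Hu s t Hs Ht.
  destruct (MVT_gen (fun r => u (clamp t0 t1 r)) s t (fun r => l r 1))
    as [c [Hc Heq]].
  - rewrite Rmin_left, Rmax_right by lra; intros r Hr.
    assert (Hloc : locally r (fun q => t0 <= q <= t1)).
    { apply (filter_imp (fun q => s < q /\ q < t)); [intros q Hq; lra|].
      apply open_and; [apply open_gt | apply open_lt | exact Hr]. }
    apply (is_derive_ext_loc u).
    { apply (filter_imp (fun q => t0 <= q <= t1)); [|exact Hloc].
      intros q Hq; rewrite clamp_id; [reflexivity | exact Hq]. }
    assert (Hr' : filterdiff u (locally r) (l r)).
    { apply (filterdiff_filter_le
               (F := within (fun q => t0 <= q <= t1) (locally r)) _ _ r);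
        [apply is_filter_lim_within | | apply Hu; lra].
      intros P HP; generalize (filter_and _ _ Hloc HP).
      apply filter_imp; intros q [H1 H2]; apply H2, H1. }
    apply (filterdiff_ext_lin u (l r)); [exact Hr'|].
    intros k; rewrite <- (Rmult_1_r k) at 1.
    exact (linear_scal (l r) (proj1 Hr') k 1).
  - rewrite Rmin_left, Rmax_right by lra; intros r Hr.
    apply continuity_pt_filterlim, (continuous_clamp t0 t1 r u); [lra|].
    apply (filterdiff_continuous_aux u); [|apply is_filter_lim_within].
    exists (l r); apply Hu; lra.
  - rewrite Rmin_left, Rmax_right in Hc by lra.
    exists c; split; [exact Hc|].
    rewrite !clamp_id in Heq by lra; exact Heq.
Qed.

(** Two uses of the mean value theorem: u(t+h) - u(t) = h u'(c), and
    |u'(c) - u'(t)| <= h sup |u''|, where the supremum is finite by compactness. *)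
Lemma Ck_on_2_taylor (t0 t1 : R) (u p : R -> R) :
  t0 < t1 -> Ck_on 2 (fun s => t0 <= s <= t1) u ->
  (forall t, t0 <= t <= t1 ->
     filterdiff u (within (fun s => t0 <= s <= t1) (locally t))
       (fun h => h * p t)) ->
  exists C : R, forall t h, t0 <= t -> 0 < h -> t + h <= t1 ->
    Rabs (u t + h * p t - u (t + h)) <= C * h ^ 2.
Proof.
  intros H01 [u' [Hu' Hu'']] Hp.
  destruct (Hu'' 1) as [u'' [Hd Hc]].
  assert (Hpu : forall t, t0 <= t <= t1 -> p t = u' t 1).
  { intros t Ht; rewrite <- (Rmult_1_l (p t)).
    exact (filterdiff_segment_unique t0 t1 t u _ _ H01 Ht (Hp t Ht) (Hu' t Ht)). }
  destruct (bounded_continuity (V := R_NormedModule)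
              (fun t => u'' (clamp t0 t1 t) 1) t0 t1) as [C HC].
  { intros t Ht; apply (continuous_clamp t0 t1 t (fun t => u'' t 1) Ht), Hc, Ht. }
  exists C; intros t h Ht Hh Hth.
  destruct (MVT_segment t0 t1 u u' Hu' t (t + h)) as [c [Hct Huc]]; [lra|lra|].
  destruct (MVT_segment t0 t1 (fun t => u' t 1) u'' Hd t c) as [d [Hdt Hud]];
    [lra|lra|].
  rewrite Hpu by lra.
  replace (u t + h * u' t 1 - u (t + h)) with (- (h * (u' c 1 - u' t 1)))
    by (replace (u (t + h)) with (u t + (u (t + h) - u t)) by ring;
        rewrite Huc; ring).
  assert (HCd : Rabs (u'' d 1) < C).
  { specialize (HC d ltac:(lra)); rewrite clamp_id in HC by lra; exact HC. }
  rewrite Hud, Rabs_Ropp, !Rabs_mult, (Rabs_pos_eq h), (Rabs_pos_eq (c - t)) by lra.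
  assert (0 <= Rabs (u'' d 1)) by apply Rabs_pos.
  assert (Rabs (u'' d 1) * (c - t) <= C * h) by (apply Rmult_le_compat; lra).
  nra.
Qed.

(** * Consistency of the limiting scheme *)

Lemma norm_pair_le {U V : NormedModule R_AbsRing} (x : U) (y : V) :
  norm ((x, y) : prod_NormedModule R_AbsRing U V) <= norm x + norm y.
Proof.
  change (sqrt (norm x ^ 2 + norm y ^ 2) <= norm x + norm y).
  assert (Hx := norm_ge_0 x); assert (Hy := norm_ge_0 y).
  rewrite <- (sqrt_pow2 (norm x + norm y)) by lra.
  apply sqrt_le_1_alt; nra.
Qed.

(** The next value is unique and given by an Euler step, so the local error is the
    Taylor remainder of order one of the exact solution. *)
Lemma limit_scheme_consistent (E : R -> R2 -> R2) (b : R -> R2 -> R) :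
  (forall t, 0 <= t -> C1_plane (b t)) ->
  (forall t x, 0 <= t -> 0 < b t x) ->
  (forall t y g, 0 <= t -> gyrokinetic E b t (y, g) =
     (gyro_velocity E b t y g, dot (E t y) (gyro_velocity E b t y g))) ->
  consistent_of_order 1 (limit_scheme E b) (gyrokinetic E b).
Proof.
  intros Hb Hpos Hgk t0 t1 u H01 [Hu Hsol].
  set (f := fun t => gyrokinetic E b t (u t)).
  (* Taylor's formula is applied to the coordinates, the mean value theorem being
     scalar. *)
  assert (Hcoord : forall pr : R2 * R -> R,
    is_linear (pr : prod_NormedModule R_AbsRing VR2 R_NormedModule -> R_NormedModule) ->
    exists C : R, forall t h, t0 <= t -> 0 < h -> t + h <= t1 ->
      Rabs (pr (u t) + h * pr (f t) - pr (u (t + h))) <= C * h ^ 2).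
  { intros pr Hpr.
    apply (Ck_on_2_taylor t0 t1 (fun t => pr (u t)) (fun t => pr (f t)));
      [lra | apply (Ck_on_linear pr 2 Hpr), Hu |].
    intros t Ht.
    apply (filterdiff_ext_lin _ (fun h : R => pr (scal h (f t))));
      [|intros h; exact (linear_scal _ Hpr h (f t))].
    apply (filterdiff_comp u pr (fun h : R => scal h (f t)) pr);
      [apply Hsol, Ht | apply filterdiff_linear, Hpr]. }
  destruct (Hcoord (fun z => fst (fst z))) as [C1 HC1];
    [apply is_linear_comp; apply is_linear_fst|].
  destruct (Hcoord (fun z => snd (fst z))) as [C2 HC2];
    [apply is_linear_comp; [apply is_linear_fst | apply is_linear_snd]|].
  destruct (Hcoord snd) as [C3 HC3]; [apply is_linear_snd|].
  exists (C1 + C2 + C3), 1; split; [apply Rlt_0_1|].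
  intros h t Hh Ht Hth.
  assert (Ht0 : 0 <= t) by lra.
  specialize (HC1 t h Ht (proj1 Hh) Hth).
  specialize (HC2 t h Ht (proj1 Hh) Hth).
  specialize (HC3 t h Ht (proj1 Hh) Hth).
  unfold f in *.
  destruct (u t) as [y g], (u (t + h)) as [[y1 y2] gh].
  rewrite Hgk in HC1, HC2, HC3 by exact Ht0.
  split.
  - eexists (_, _); apply limit_scheme_iff_Euler; auto; lra.
  - intros [[v1 v2] g'] Hv.
    apply limit_scheme_iff_Euler in Hv; auto; [|lra].
    destruct Hv as [Hv Hg].
    assert (Hv1 := f_equal fst Hv); assert (Hv2 := f_equal snd Hv).
    set (V := gyro_velocity E b t y g) in *.
    change (v1 = fst y + h * fst V) in Hv1.
    change (v2 = snd y + h * snd V) in Hv2.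
    change (Rabs (fst y + h * fst V - y1) <= C1 * h ^ 2) in HC1.
    change (Rabs (snd y + h * snd V - y2) <= C2 * h ^ 2) in HC2.
    change (Rabs (g + h * dot (E t y) V - gh) <= C3 * h ^ 2) in HC3.
    rewrite <- Hv1 in HC1; rewrite <- Hv2 in HC2; rewrite <- Hg in HC3.
    eapply Rle_trans; [apply (norm_pair_le (U := VR2) (V := R_NormedModule))|].
    eapply Rle_trans;
      [apply Rplus_le_compat_r, (norm_pair_le (U := R_NormedModule) (V := R_NormedModule))|].
    change (Rabs (v1 - y1) + Rabs (v2 - y2) + Rabs (g' - gh)
            <= (C1 + C2 + C3) * h ^ 2).
    lra.
Qed.
(** * Convergence of the scheme and consistency of its limit *)

Theorem proposition2p1
  (E : R -> R2 -> R2) (b : R -> R2 -> R) (b0 : R) (chi : R -> R2 -> R)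
  (E_smooth : smooth_field E) (b_smooth : smooth_field b)
  (b0_pos : 0 < b0)
  (b_lower : forall (t : R) (x : R2), 0 <= t -> b0 <= b t x)
  (E_potential : derives_from_potential E)
  (chi_adm : admissible_chi chi)
  (dt T : R) (dt_pos : 0 < dt) (T_pos : 0 < T)
  (N : nat) (N_def : N = Z.to_nat (Int_part (T / dt)))
  (x w : R -> nat -> R2) (e : R -> nat -> R)
  (x_w_e_scheme : forall (eps : R) (n : nat), 0 < eps -> (n + 1 <= N)%nat ->
     scheme E b chi eps dt (INR n * dt)
       (x eps n) (w eps n) (e eps n)
       (x eps (n + 1)%nat) (w eps (n + 1)%nat) (e eps (n + 1)%nat))
  (bounded : forall n : nat, (1 <= n <= N)%nat ->
     exists M : R, forall eps : R, 0 < eps ->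
       norm (x eps n) <= M /\ norm (scal eps (w eps n)) <= M /\
       Rabs (e eps n) <= M)
  (y0 w0 : R2) (g0 : R)
  (x0_cvg : filterlim (fun eps => x eps 0%nat) (at_right 0) (locally y0))
  (w0_cvg : filterlim (fun eps => w eps 0%nat) (at_right 0) (locally w0))
  (e0_cvg : filterlim (fun eps => e eps 0%nat) (at_right 0) (locally g0)) :
  (exists (y : nat -> R2) (g : nat -> R),
     (forall n : nat, (1 <= n <= N)%nat ->
        filterlim (fun eps => x eps n) (at_right 0) (locally (y n)) /\
        filterlim (fun eps => e eps n) (at_right 0) (locally (g n))) /\
     (forall n : nat, (1 <= n)%nat -> (n + 1 <= N)%nat ->
        limit_scheme E b dt (INR n * dt)
          (y n, g n) (y (n + 1)%nat, g (n + 1)%nat))) /\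
  consistent_of_order 1 (limit_scheme E b) (gyrokinetic E b).
Proof.
  assert (b_pos : forall t x, 0 <= t -> 0 < b t x)
    by (intros t z Ht; specialize (b_lower t z Ht); lra).
  assert (b_C1 : forall t, 0 <= t -> C1_plane (b t))
    by (intros t; apply smooth_field_C1_slice, b_smooth).
  destruct (smooth_field_components E E_smooth) as [HE1 HE2].
  assert (E1_C1 : forall t, 0 <= t -> C1_plane (fun z => fst (E t z)))
    by (intros t; apply (smooth_field_C1_slice _ t HE1)).
  assert (E2_C1 : forall t, 0 <= t -> C1_plane (fun z => snd (E t z)))
    by (intros t; apply (smooth_field_C1_slice _ t HE2)).
  assert (E_cont : forall t z, 0 <= t -> continuous (E t) z).
  { intros t z Ht.
    apply continuous_ext with (f := fun z => (fst (E t z), snd (E t z)));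
      [intros z'; symmetry; apply surjective_pairing|].
    apply filterlim_pair_comp; [apply (E1_C1 t Ht) | apply (E2_C1 t Ht)]. }
  assert (time_ge0 : forall n, 0 <= INR n * dt)
    by (intros n; apply Rmult_le_pos; [apply pos_INR | lra]).
  split.
  - set (s := limit_seq E b dt (chi g0 w0) (y0, g0)).
    exists (fun n => fst (s n)), (fun n => snd (s n)).
    assert (Hs : forall n, s (S n) =
              let q := match n with O => chi g0 w0 | S _ => snd (s n) end in
              let V := gyro_velocity E b (INR n * dt) (fst (s n)) q in
              (plus (fst (s n)) (scal dt V),
               snd (s n) + dt * dot (E (INR n * dt) (fst (s n))) V)).
    { intros n; unfold s; cbn [limit_seq].
      destruct (limit_seq E b dt (chi g0 w0) (y0, g0) n); reflexivity. }
    assert (Hlim : forall n, (n <= N)%nat ->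
      filterlim (fun eps => x eps n) (at_right 0) (locally (fst (s n))) /\
      filterlim (fun eps => e eps n) (at_right 0) (locally (snd (s n))) /\
      filterlim (fun eps => w eps n) (at_right 0)
        (locally (match n with O => w0 | S _ => (zero : R2) end))).
    { (* The limit of w^n is 0 once a step has been made. *)
      induction n as [|n IH]; intros Hn; [repeat split; assumption|].
      destruct IH as [Hx [He Hw]]; [lia|].
      assert (Hchi : filterlim (fun eps => chi (e eps n) (w eps n)) (at_right 0)
                (locally (match n with O => chi g0 w0 | S _ => snd (s n) end))).
      { assert (Hc : forall wl : R2,
                  filterlim (fun eps => w eps n) (at_right 0) (locally wl) ->
                  filterlim (fun eps => chi (e eps n) (w eps n)) (at_right 0)
                    (locally (chi (snd (s n)) wl))).
        { intros wl Hwl.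
          apply (filterlim_comp _ _ _ (fun eps => (e eps n, w eps n))
                   (fun q : R * R2 => chi (fst q) (snd q)) _
                   (locally ((snd (s n), wl) : R * R2)));
            [apply filterlim_pair_comp; assumption | apply (proj1 chi_adm)]. }
        destruct n as [|n]; [exact (Hc _ Hw)|].
        rewrite <- (chi_zero_velocity chi (snd (s (S n))) chi_adm).
        exact (Hc _ Hw). }
      rewrite Hs.
      assert (Hstep : forall eps, 0 < eps ->
                scheme E b chi eps dt (INR n * dt) (x eps n) (w eps n) (e eps n)
                  (x eps (S n)) (w eps (S n)) (e eps (S n))).
      { intros eps Heps; rewrite <- (Nat.add_1_r n).
        apply x_w_e_scheme; [exact Heps | lia]. }
      destruct (scheme_step_limit E b chi dt (INR n * dt) _ _ _ _ _ _ _ _ _ _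
                  dt_pos (fun z => E_cont _ z (time_ge0 n)) (b_C1 _ (time_ge0 n))
                  (fun z => b_pos _ z (time_ge0 n)) Hstep Hx Hw He Hchi)
        as [Hx' [Hw' He']].
      auto. }
    split.
    + intros n Hn; destruct (Hlim n) as [Hx [He _]]; [lia|]; auto.
    + intros n Hn1 HnN; rewrite Nat.add_1_r, Hs; cbv zeta.
      destruct n as [|n]; [lia|].
      apply limit_scheme_iff_Euler; auto.
  - apply limit_scheme_consistent; auto.
    intros t y g Ht.
    apply gyrokinetic_eq_velocity; auto.
    apply potential_curl_free; auto.
Qed.
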